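(* Let $d\ge1$ and let $P$ be a non-degenerate elliptical distribution on $\mathbb{R}^d$. Let $\mathcal{L}$ be a set of lines through the origin in $\mathbb{R}^d$ containing strictly fewer than $(d^2+d)/2$ lines. Then there exists a non-degenerate elliptical distribution $Q$ on $\mathbb{R}^d$ such that $P_L=Q_L$ for all $L\in\mathcal{L}$, but $P\ne Q$.
   Context: A Borel probability measure $P$ on $\mathbb{R}^d$ is an elliptical distribution if its characteristic function $\phi_P(\xi)=\int e^{ix\cdot\xi}\,dP(x)$ has the form $\phi_P(\xi)=e^{i\mu\cdot\xi}\psi(\xi^\top\Sigma\xi)$ for all $\xi\in\mathbb{R}^d$, where $\Sigma$ is a real (symmetric) positive semi-definite $d\times d$ matrix, $\mu\in\mathbb{R}^d$, and $\psi:[0,\infty)\to\mathbb{C}$ is continuous ($\mu,\Sigma,\psi$ may depend on $P$). A Borel probability measure on $\mathbb{R}^d$ is non-degenerate if it is not supported in any hyperplane, where a hyperplane is a set $\{x\in\mathbb{R}^d: y\cdot x=c\}$ with $y\in\mathbb{R}^d\setminus\{0\}$ and $c\in\mathbb{R}$. For a one-dimensional vector subspace (line) $L\subset\mathbb{R}^d$ with orthogonal projection $\pi_L:\mathbb{R}^d\to L$, $P_L$ denotes the Borel probability measure on $L$ given by $P_L(B)=P(\pi_L^{-1}(B))$. *)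

(* Defs.v *)
From HB Require Import structures.
From mathcomp Require Import all_boot all_order all_algebra.
From mathcomp Require Import complex.
From mathcomp Require Import all_classical all_reals all_analysis.
Set Implicit Arguments.
Unset Strict Implicit.
Unset Printing Implicit Defensive.
Import Order.TTheory GRing.Theory Num.Theory.
Import numFieldNormedType.Exports.
Local Open Scope classical_set_scope.
Local Open Scope ring_scope.
Local Open Scope complex_scope.

(* Points of R^d are row vectors. *)
Notation borel_space R d := (g_sigma_algebraType (@open 'rV[R]_d)).

Definition dotrv (R : realType) (d : nat) (x y : 'rV[R]_d) : R :=
  \sum_(i < d) x 0 i * y 0 i.

(* A measure is a total set function which is unconstrained on non-measurable
   sets, so equality of measures is equality on measurable sets, not [=]. *)
Definition eq_on_measurable (disp : measure_display) (T : measurableType disp)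
    (R : realType) (mu nu : set T -> \bar R) : Prop :=
  forall B : set T, measurable B -> mu B = nu B.

Section characteristic_function.
Context (R : realType).

Definition expi (t : R) : R[i] := cos t +i* sin t.

(* The library has no integral of complex-valued functions. *)
Definition cintegral (disp : measure_display) (T : measurableType disp)
    (P : probability T R) (f : T -> R[i]) : R[i] :=
  (\int[P]_x complex.Re (f x))%R +i* (\int[P]_x complex.Im (f x))%R.

Definition charfun (d : nat) (P : probability (borel_space R d) R)
    (xi : 'rV[R]_d) : R[i] :=
  cintegral P (fun x => expi (dotrv x xi)).

End characteristic_function.

Section elliptical.
Context (R : realType) (d : nat).

Definition quad_form (S : 'M[R]_d) (x : 'rV[R]_d) : R :=
  (x *m S *m x^T) 0 0.

Definition pos_semidef (S : 'M[R]_d) : Prop :=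
  S^T = S /\ forall x : 'rV[R]_d, 0 <= quad_form S x.

(* [psi] is total, but only its values and its continuity on [0, +oo[ matter.
   The cast equips R[i] with the topology of the complex modulus. *)
Definition elliptical (P : probability (borel_space R d) R) : Prop :=
  exists (mu : 'rV[R]_d) (Sigma : 'M[R]_d) (psi : R -> (R[i] : numFieldType)),
    [/\ pos_semidef Sigma,
        {within `[0, +oo[, continuous psi}
      & forall xi : 'rV[R]_d,
          charfun P xi = expi (dotrv mu xi) * psi (quad_form Sigma xi)].

Definition hyperplane (y : 'rV[R]_d) (c : R) : set 'rV[R]_d :=
  [set x | dotrv y x = c].

Definition nondegenerate_measure (P : probability (borel_space R d) R) : Prop :=
  forall (y : 'rV[R]_d) (c : R), y != 0 -> P (hyperplane y c) <> 1%E.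

End elliptical.

HB.instance Definition _ (K : fieldType) (V : vectType K) (L : {vspace V}) :=
  isPointed.Build (subvs_of L) 0.

(* The subspace [L] with the Borel sigma-algebra of its subspace topology. *)
Notation borel_subspace L := (g_sigma_algebraType
  (@open (initial_topology (vsval : subvs_of L -> _)))).

Section marginal.
Context (R : realType) (d : nat).
Implicit Types (L : {vspace 'rV[R]_d}) (x : 'rV[R]_d).

(* The unique y in L such that x - y is orthogonal to L; see [orthprojP] and
   [orthproj_unique]. *)
Definition orthproj L x : subvs_of L :=
  xget 0 [set y | forall w, w \in L -> dotrv (x - vsval y) w = 0].

Definition marginal (P : probability (borel_space R d) R) L :
    set (borel_subspace L) -> \bar R :=
  pushforward P (orthproj L : borel_space R d -> borel_subspace L).

Lemma dotrvBl (x y w : 'rV[R]_d) : dotrv (x - y) w = dotrv x w - dotrv y w.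
Proof.
by rewrite /dotrv -sumrB; apply: eq_bigr => i _; rewrite !mxE mulrBl.
Qed.

Lemma dotrvZl (a : R) (x w : 'rV[R]_d) : dotrv (a *: x) w = a * dotrv x w.
Proof.
by rewrite /dotrv mulr_sumr; apply: eq_bigr => i _; rewrite !mxE mulrA.
Qed.

Lemma dotrvZr (a : R) (x w : 'rV[R]_d) : dotrv x (a *: w) = a * dotrv x w.
Proof.
by rewrite /dotrv mulr_sumr; apply: eq_bigr => i _; rewrite !mxE mulrCA.
Qed.

Lemma dotrvv_eq0 x : (dotrv x x == 0) = (x == 0).
Proof.
apply/eqP/eqP => [x0|->]; last by rewrite /dotrv big1// => i _; rewrite mxE mul0r.
apply/rowP => i; rewrite mxE; apply/eqP.
have /psumr_eq0P/(_ x0)/(_ i isT)/eqP : forall j : 'I_d, true -> 0 <= x 0 j * x 0 j.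
  by move=> j _; rewrite -expr2 sqr_ge0.
by rewrite mulf_eq0 orbb.
Qed.

Lemma orthprojP L x : \dim L = 1%N ->
  forall w, w \in L -> dotrv (x - vsval (orthproj L x)) w = 0.
Proof.
move=> dL; rewrite /orthproj; case: xgetP => [//|/(_ (vsproj L _)) nex].
have v0 : vpick L != 0 by rewrite vpick0 -dimv_eq0 dL.
have LE : L = <[vpick L]>%VS.
  apply/eqP; rewrite eq_sym eqEdim dL dim_vline v0 leqnn andbT.
  by rewrite -memvE memv_pick.
pose a := dotrv x (vpick L) / dotrv (vpick L) (vpick L).
exfalso; apply: (nex (a *: vpick L)) => w /=.
rewrite vsprojK ?rpredZ ?memv_pick// {1}LE => /vlineP[k ->].
by rewrite dotrvZr dotrvBl dotrvZl /a divfK ?subrr ?mulr0// dotrvv_eq0.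
Qed.

Lemma orthproj_unique L x (y z : subvs_of L) :
  (forall w, w \in L -> dotrv (x - vsval y) w = 0) ->
  (forall w, w \in L -> dotrv (x - vsval z) w = 0) -> y = z.
Proof.
move=> hy hz; apply/val_inj/eqP; rewrite -subr_eq0 -dotrvv_eq0 /=.
have yzE : vsval y - vsval z = (x - vsval z) - (x - vsval y).
  by rewrite opprB [RHS]addrC addrA subrK.
have yzL : vsval y - vsval z \in L by rewrite rpredB ?subvsP.
by rewrite {1}yzE dotrvBl hz// hy// subrr.
Qed.

End marginal.

Arguments marginal {R d} P L _.

(* Main.v *)
Require Import Defs.
From mathcomp Require Import all_boot all_order all_algebra.
From mathcomp Require Import all_classical all_reals all_analysis.
From mathcomp Require Import measurable_realfun ring lra complex.
Set Implicit Arguments.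
Unset Strict Implicit.
Unset Printing Implicit Defensive.
Import Order.TTheory GRing.Theory Num.Theory.
Import numFieldNormedType.Exports.
Local Open Scope classical_set_scope.
Local Open Scope card_scope.
Local Open Scope ring_scope.

(** Write mu, Sigma, psi for the parameters of P. The measure Q is the image
    of P under an affine map x |-> mu + (x - mu) A^T; its characteristic
    function is again elliptical, with the same mu and psi and with
    A Sigma A^T in the place of Sigma ([affine_image], [quad_form_congr]).
    Hence everything reduces to a choice of A, that is, of the new matrix.

    The symmetric d x d matrices form a space of dimension (d^2 + d) / 2, so
    that fewer than (d^2 + d) / 2 lines leave a nonzero symmetric M with
    x M x^T = 0 on all of them ([isotropic_form]). Since P is not degenerate,
    Sigma is positive definite ([pos_def_of_nondegenerate]), so Sigma + e M is
    still positive definite for small e > 0, and two Cholesky factorizations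
    give an invertible A with A Sigma A^T = Sigma + e M
    ([congruent_perturbation]).

    On a line L of the family the two quadratic forms agree, so the
    characteristic functions of P and Q agree on L. As the characteristic
    function determines a law on the real line ([law_eq_of_charfun]), the
    projections of P and Q on L are equal ([marginal_eq]).

    If P and Q were equal, then psi (t^2 a) = psi (t^2 b) for all t, where
    a <> b are the positive values of the two forms at a point where M does
    not vanish. Iterating this identity and using the continuity of psi at 0
    makes psi constant ([cst_of_rescale]), so that P would have the
    characteristic function of a Dirac mass, which is degenerate
    ([degenerate_of_charfun]).

    Uniqueness on the real line is proved without inversion formulas. Equality
    of the integrals of all cos (t x + s) extends to trigonometric polynomials,
    and then to all uniformly bounded pointwise limits. The function
    |sin (t x + s)| is such a limit, because the iteration for the square root
    of sin^2 stays polynomial. Rescaling yields |x - a| - |x - b|, whose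
    difference quotients converge to the indicators of the rays ]a, +oo[, and
    the rays determine the law. *)

(** * Quadratic forms and symmetric matrices *)

Section quadratic_forms.
Context (R : realType).

Lemma dotrvE n (x y : 'rV[R]_n) : dotrv x y = (x *m y^T) 0 0.
Proof. by rewrite /dotrv !mxE; apply: eq_bigr => i _; rewrite mxE. Qed.

Lemma dotrvC n (x y : 'rV[R]_n) : dotrv x y = dotrv y x.
Proof. by apply: eq_bigr => i _; rewrite mulrC. Qed.

Lemma dotrv_mul n (x y : 'rV[R]_n) (A : 'M[R]_n) :
  dotrv (x *m A^T) y = dotrv x (y *m A).
Proof. by rewrite !dotrvE trmx_mul mulmxA. Qed.

Lemma dotrvv_ge0 n (x : 'rV[R]_n) : 0 <= dotrv x x.
Proof. by apply: sumr_ge0 => i _; rewrite -expr2 sqr_ge0. Qed.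

Lemma quad_formD n (S T : 'M[R]_n) x :
  quad_form (S + T) x = quad_form S x + quad_form T x.
Proof. by rewrite /quad_form mulmxDr mulmxDl mxE. Qed.

Lemma quad_formZ n a (S : 'M[R]_n) x : quad_form (a *: S) x = a * quad_form S x.
Proof. by rewrite /quad_form -scalemxAr -scalemxAl mxE. Qed.

Lemma quad_form_scale n (S : 'M[R]_n) a x :
  quad_form S (a *: x) = a ^+ 2 * quad_form S x.
Proof.
by rewrite /quad_form linearZ/= -!scalemxAl -scalemxAr !mxE mulrA expr2.
Qed.

Lemma quad_form_congr n (A S : 'M[R]_n) x :
  quad_form (A *m S *m A^T) x = quad_form S (x *m A).
Proof. by rewrite /quad_form trmx_mul !mulmxA. Qed.

Lemma quad_form_gram n (C : 'M[R]_n) x :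
  quad_form (C *m C^T) x = dotrv (x *m C) (x *m C).
Proof. by rewrite dotrvE trmx_mul /quad_form !mulmxA. Qed.

Lemma quad_formE n (S : 'M[R]_n) x :
  quad_form S x = \sum_i \sum_j S i j * (x 0 i * x 0 j).
Proof.
rewrite /quad_form mxE exchange_big/=; apply: eq_bigr => j _.
by rewrite !mxE big_distrl/=; apply: eq_bigr => i _; ring.
Qed.

Definition pos_def n (S : 'M[R]_n) : Prop :=
  S^T = S /\ forall x : 'rV[R]_n, x != 0 -> 0 < quad_form S x.

(** By induction on the size: with S = [a, b; b^T, S'], the entry a is the
    value of the form at the first basis vector, and the Schur complement
    S' - a^-1 b^T b is positive definite because its value at x is the value
    of S at (- a^-1 b x^T, x), the minimum over the first coordinate. *)
Lemma cholesky n (S : 'M[R]_n) : pos_def S -> exists C : 'M[R]_n, S = C *m C^T.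
Proof.
elim: n S => [|n IHn] S; first by exists 0; apply/matrixP => -[].
rewrite -[S](@submxK _ 1 n 1 n).
set a := ulsubmx _; set b := ursubmx _; set b' := dlsubmx _.
set S' := drsubmx _.
case; rewrite (@tr_block_mx _ 1 n 1 n).
move=> /(@eq_block_mx _ 1 n 1 n)[_ b'E _ S'sym] Spos.
have {}b'E : b' = b^T by rewrite -b'E trmxK.
clearbody a b b' S'; subst b'.
have quadE t (x : 'rV[R]_n) : quad_form (block_mx a b b^T S') (row_mx t%:M x) =
    a 0 0 * t ^+ 2 + 2 * t * (b *m x^T) 0 0 + quad_form S' x.
  rewrite /quad_form (@mul_row_block _ 1 1 n 1 n) (@tr_row_mx _ 1 1 n).
  rewrite (@mul_row_col _ 1 1 n 1) !mulmxDl tr_scalar_mx.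
  rewrite !mul_scalar_mx !mul_mx_scalar.
  have -> : x *m b^T = (b *m x^T)^T by rewrite trmx_mul trmxK.
  by rewrite -!scalemxAl !mxE; ring.
have a_gt0 : 0 < a 0 0.
  have := Spos (row_mx 1%:M 0); rewrite quadE/quad_form trmx0 !mulmx0 !mxE.
  rewrite expr1n mulr1 !mulr0 !addr0; apply.
  apply/eqP => /(congr1 (@lsubmx _ 1 1 n)); rewrite row_mxKl.
  move=> /matrixP/(_ 0 0)/eqP.
  by rewrite !mxE oner_eq0.
have [|C' C'E] := IHn (S' - (a 0 0)^-1 *: (b^T *m b)).
  split=> [|x x0]; first by rewrite linearB/= linearZ/= trmx_mul trmxK S'sym.
  rewrite quad_formD -scaleNr quad_formZ.
  (* The first coordinate that minimizes the form over all (t, x). *)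
  have := Spos (row_mx (- ((b *m x^T) 0 0 / a 0 0))%:M x).
  rewrite quadE.
  have -> : quad_form (b^T *m b) x = (b *m x^T) 0 0 ^+ 2.
    rewrite /quad_form !mulmxA.
    have -> : x *m b^T *m b *m x^T = (b *m x^T)^T *m (b *m x^T).
      by rewrite trmx_mul trmxK !mulmxA.
    by rewrite mxE big_ord1 mxE expr2.
  set u := (b *m x^T) 0 0; set q := quad_form S' x.
  have -> : a 0 0 * (- (u / a 0 0)) ^+ 2 + 2 * - (u / a 0 0) * u + q =
            q + - (a 0 0)^-1 * u ^+ 2 by field; rewrite gt_eqF.
  apply; apply: contraNneq x0 => /(congr1 (@rsubmx _ 1 1 n)).
  by rewrite row_mxKr linear0 => ->.
pose r := Num.sqrt (a 0 0).
have r0 : r != 0 by rewrite gt_eqF// sqrtr_gt0.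
have rr : r * r = a 0 0 by rewrite -expr2 sqr_sqrtr// ltW.
exists (block_mx r%:M 0 (r^-1 *: b^T) C').
rewrite (@tr_block_mx _ 1 n 1 n) (@mulmx_block _ 1 n 1 n 1 n) -C'E.
rewrite !mul0mx !trmx0 !mulmx0 !addr0 tr_scalar_mx linearZ/= trmxK.
rewrite mul_scalar_mx mul_scalar_mx mul_mx_scalar !scalerA divff// scale1r.
rewrite -scalemxAr -scalemxAl scalerA -rr invfM addrCA subrr addr0 scale1r.
by have -> : r *: r%:M = a;
  [apply/matrixP => i j; rewrite !ord1 !mxE/= mulr1n rr|].
Qed.

Lemma pos_def_root n (S : 'M[R]_n) :
  pos_def S -> exists2 C : 'M[R]_n, C \in unitmx & S = C *m C^T.
Proof.
move=> Spos; have [C SC] := cholesky Spos; exists C => //.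
rewrite -row_free_unit -kermx_eq0; apply/eqP/row_matrixP => i.
rewrite row0; apply/eqP.
apply/negPn/negP => /(proj2 Spos).
rewrite SC quad_form_gram -row_mul mulmx_ker row0 /dotrv big1 ?ltxx//.
by move=> j _; rewrite mxE mul0r.
Qed.

(** Each product of two coordinates is at most the squared norm. *)
Lemma quad_form_bound n (N : 'M[R]_n) y :
  `|quad_form N y| <= (\sum_i \sum_j `|N i j|) * dotrv y y.
Proof.
rewrite quad_formE mulr_suml (le_trans (ler_norm_sum _ _ _))//.
apply: ler_sum => i _; rewrite mulr_suml (le_trans (ler_norm_sum _ _ _))//.
apply: ler_sum => j _; rewrite normrM ler_wpM2l//.
have yk k : y 0 k ^+ 2 <= dotrv y y.
  rewrite /dotrv (bigD1 k)//= -expr2 lerDl sumr_ge0// => l _.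
  by rewrite -expr2 sqr_ge0.
have := yk i; have := yk j; rewrite ler_norml; nra.
Qed.

(** With S = C C^T, the form of S + e M at x is |y|^2 + e (y N y^T), where
    y = x C and N = C^-1 M C^-T, so it is positive as soon as e K < 1, K being
    the bound of [quad_form_bound] for N. If D D^T is a factorization of
    S + e M, then A = D C^-1. *)
Lemma congruent_perturbation n (S M : 'M[R]_n) : pos_def S -> M^T = M ->
  exists2 e : R, 0 < e &
    exists2 A : 'M[R]_n, A \in unitmx & A *m S *m A^T = S + e *: M.
Proof.
move=> Spos Msym; have [C Cu SC] := pos_def_root Spos.
pose N := invmx C *m M *m (invmx C)^T.
pose K : R := \sum_i \sum_j `|N i j|.
have K0 : 0 <= K by apply: sumr_ge0 => i _; apply: sumr_ge0.
exists (K + 1)^-1; first by rewrite invr_gt0 ltr_wpDl.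
set e := (K + 1)^-1.
have Seps : pos_def (S + e *: M).
  split=> [|x x0]; first by rewrite linearD/= linearZ/= Msym (proj1 Spos).
  have -> : M = C *m N *m C^T.
    rewrite /N !mulmxA mulmxV// mul1mx -mulmxA -trmx_mul mulmxV//.
    by rewrite trmx1 mulmx1.
  rewrite quad_formD quad_formZ SC quad_form_congr quad_form_gram.
  have := quad_form_bound N (x *m C); rewrite -/K.
  have : 0 < dotrv (x *m C) (x *m C).
    rewrite lt_def dotrvv_ge0 dotrvv_eq0 andbT.
    by apply: contraNneq x0 => xC0; rewrite -(mulmxK Cu x) xC0 mul0mx.
  set q := quad_form _ _; set D := dotrv _ _ => D0 qD.
  have -> : D + e * q = e * (K * D + D + q).
    by rewrite /e; field; rewrite gt_eqF// ltr_wpDl.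
  apply: mulr_gt0; first by rewrite invr_gt0 ltr_wpDl.
  by move: qD; rewrite ler_norml; lra.
have [D Du SD] := pos_def_root Seps; exists (D *m invmx C).
  by rewrite unitmx_mul Du unitmx_inv.
rewrite SD SC trmx_mul !mulmxA mulmxKV// -[D *m C^T *m _]mulmxA -trmx_mul.
by rewrite mulVmx// trmx1 mulmx1.
Qed.

(** Polarization recovers the entries of M from its quadratic form. *)
Lemma quad_form_neq0 n (M : 'M[R]_n) : M^T = M -> M != 0 ->
  exists x, quad_form M x != 0.
Proof.
move=> Msym Mn0; apply: contrapT => nex; case/eqP: Mn0; apply/matrixP => i j.
have M0 x : quad_form M x = 0.
  by apply/eqP/negPn/negP => Mx; apply: nex; exists x.
pose e (k : 'I_n) : 'rV[R]_n := delta_mx 0 k.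
have bE k l : M k l = (e k *m M *m (e l)^T) 0 0.
  by rewrite -rowE trmx_delta -colE !mxE.
pose q k l := (e k *m M *m (e l)^T) 0 0.
have qij : quad_form M (e i + e j) = q i i + q j i + (q i j + q j j).
  rewrite /q /quad_form linearD/= !mulmxDl !mulmxDr addrACA mxE.
  by congr (_ + _); rewrite mxE.
have Mji : M j i = M i j by rewrite -{1}Msym mxE.
move: qij; rewrite M0 /q -!bE Mji mxE.
have := M0 (e i); have := M0 (e j); rewrite /quad_form -!bE => -> ->.
lra.
Qed.

(** The transposed triangle has the same cardinality; the two cover the
    square and meet along the diagonal. *)
Lemma card_triangle n :
  #|[set p : 'I_n * 'I_n | (p.1 <= p.2)%N]%SET| = ((n ^ 2 + n) %/ 2)%N.
Proof.
set T := [set p | _]%SET; pose T' := [set p : 'I_n * 'I_n | (p.2 <= p.1)%N]%SET.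
have TT' : #|T'| = #|T|.
  rewrite -(card_imset _ (f := fun p : 'I_n * 'I_n => (p.2, p.1))); last first.
    by move=> [? ?] [? ?] [-> ->].
  apply: eq_card => -[i j].
  apply/imsetP/idP => [[[k l] + [-> ->]]|]; rewrite !inE//= => ij.
  by exists (j, i); rewrite ?inE.
have UE : (T :|: T')%SET = [set: 'I_n * 'I_n]%SET.
  by apply/setP => -[i j]; rewrite !inE/= leq_total.
have IE : #|(T :&: T')%SET| = n.
  rewrite -[RHS]card_ord -cardsT.
  rewrite -(card_imset _ (f := fun i : 'I_n => (i, i))); last by move=> i j [].
  apply: eq_card => -[i j]; rewrite !inE/= -eqn_leq.
  by apply/eqP/imsetP => [/val_inj ->|[k _ [-> ->]]//]; exists j.
have := cardsUI T T'; rewrite UE IE TT' cardsT card_prod !card_ord mulnn => ->.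
by rewrite addnn -muln2 mulnK.
Qed.

Lemma quad_form_delta n (i j : 'I_n) (x : 'rV[R]_n) :
  quad_form (delta_mx i j) x = x 0 i * x 0 j.
Proof.
rewrite quad_formE (bigD1 i)//= (bigD1 j)//= mxE !eqxx mul1r.
rewrite !big1 ?addr0// => [k ki|k kj]; last first.
  by rewrite mxE (negPf kj) andbF mul0r.
by rewrite big1// => l _; rewrite mxE (negPf ki) mul0r.
Qed.

Lemma quad_formT n (S : 'M[R]_n) x : quad_form S^T x = quad_form S x.
Proof.
rewrite !quad_formE exchange_big; apply: eq_bigr => i _; apply: eq_bigr => j _.
by rewrite mxE [x 0 j * _]mulrC.
Qed.

(** Linear algebra on the coefficients z of an upper triangular matrix U: the
    n conditions on z are linear and there are more than n coefficients, so
    some z <> 0 satisfies them. The matrix is the symmetrization U + U^T, which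
    is nonzero since its entries above the diagonal are those of U and its
    diagonal is twice that of U. *)
Lemma isotropic_form d n (v : 'I_n -> 'rV[R]_d) : (n < (d ^ 2 + d) %/ 2)%N ->
  exists M : 'M[R]_d, [/\ M^T = M, M != 0 & forall k, quad_form M (v k) = 0].
Proof.
rewrite -card_triangle; set T := [set p | _]%SET => hn.
pose ij (t : 'I_#|T|) := enum_val t.
(* z *m W lists the values at the v k of the form with coefficients z. *)
pose W : 'M[R]_(#|T|, n) := \matrix_(t, k) (v k 0 (ij t).1 * v k 0 (ij t).2).
have : kermx W != 0.
  by rewrite kermx_eq0 /row_free neq_ltn (leq_ltn_trans (rank_leq_col _)).
case/rowV0Pn => z /sub_kermxP zW z0.
pose U : 'M[R]_d := \sum_t z 0 t *: delta_mx (ij t).1 (ij t).2.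
have qU k : quad_form U (v k) = 0.
  have -> : quad_form U (v k) = (z *m W) 0 k.
    rewrite (big_morph (fun A => quad_form A (v k))
                       (fun A B => quad_formD A B _) (id1 := 0)).
      rewrite mxE; apply: eq_bigr => t _.
      by rewrite quad_formZ quad_form_delta mxE.
    rewrite quad_formE big1// => i _.
    by rewrite big1// => j _; rewrite mxE mul0r.
  by rewrite zW mxE.
have UE i j : U i j = \sum_(t | ij t == (i, j)) z 0 t.
  rewrite summxE [RHS]big_mkcond; apply: eq_bigr => t _; rewrite !mxE.
  rewrite -[_ == (i, j)]/((_ == i) && (_ == j)) [i == _]eq_sym [j == _]eq_sym.
  by case: ifP; rewrite ?mulr1 ?mulr0.
exists (U + U^T); split.
- by rewrite linearD/= trmxK addrC.
- apply: contraNneq z0 => M0; apply/eqP/rowP => t; rewrite [RHS]mxE.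
  have Utt : U (ij t).1 (ij t).2 = z 0 t.
    rewrite UE (big_pred1 t)// => s /=; rewrite -surjective_pairing.
    by apply/eqP/eqP => [/enum_val_inj|->].
  have : (U + U^T) (ij t).1 (ij t).2 = 0 by rewrite M0 mxE.
  rewrite mxE [_^T _ _]mxE Utt.
  have [e|ne] := eqVneq (ij t).1 (ij t).2.
    have -> : U (ij t).2 (ij t).1 = z 0 t by rewrite -{1}e {2}e Utt.
    lra.
  rewrite UE big1 ?addr0// => s /eqP es.
  have := enum_valP s; have := enum_valP t; rewrite !inE -/(ij t) -/(ij s) es/=.
  move=> le1 le2; case/negP: ne; apply/eqP/val_inj/anti_leq.
  by rewrite le1 le2.
- by move=> k; rewrite quad_formD quad_formT qU addr0.
Qed.

End quadratic_forms.

(** * Sines, square roots and ramps *)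

Section sine_bounds.
Context (R : realType).

Lemma sin_lipschitz (x y : R) : `|sin x - sin y| <= `|x - y|.
Proof.
wlog yx : x y / y <= x.
  by move=> H; have [/H//|/ltW/H] := leP y x; rewrite distrC [leRHS]distrC.
have [c _ ->] : exists2 c, c \in `[y, x]%R & sin x - sin y = cos c * (x - y).
  apply: MVT_segment => //; apply: continuous_subspaceT.
  exact: continuous_sin.
by rewrite normrM ler_piMl// cos_max.
Qed.

(** This is the derivative of sin at 0, taken along the sequence y / (n + 1). *)
Lemma cvg_sin_slope (y : R) : n.+1%:R * sin (y / n.+1%:R) @[n --> \oo] --> y.
Proof.
have [->|y0] := eqVneq y 0.
  by under eq_fun do rewrite mul0r sin0 mulr0; exact: cvg_cst.
have sin'0 : h^-1 * sin h @[h --> (0 : R)^'] --> (1 : R).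
  rewrite -[X in _ --> X]cos0 -(@derive_val _ _ _ _ _ _ _ (is_derive_sin 0)).
  have -> : (fun h : R => h^-1 * sin h) =
            (fun h : R => h^-1 *: (sin (h *: (1 : R) + 0) - sin 0)).
    by apply/funext => h; rewrite sin0 subr0 addr0 /GRing.scale/= mulr1.
  exact: derivable_sin.
have yn : y / n.+1%:R @[n --> \oo] --> (0 : R)^'.
  have y0n : y / n.+1%:R @[n --> \oo] --> (0 : R).
    rewrite -[X in _ --> X](mulr0 y).
    by apply: cvgM; [exact: cvg_cst|exact: cvg_harmonic].
  move=> A A0.
  have : \forall n \near \oo, (y / n.+1%:R != 0 -> A (y / n.+1%:R)).
    exact: y0n _ A0.
  apply: filterS => n; apply; apply: mulf_neq0 => //.
have -> : (fun n => n.+1%:R * sin (y / n.+1%:R)) =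
          (fun n => y * ((y / n.+1%:R)^-1 * sin (y / n.+1%:R))).
  apply/funext => n; have : n.+1%:R != 0 :> R by rewrite pnatr_eq0.
  by move: n.+1%:R => m m0; field; rewrite m0.
rewrite -[y in X in _ --> X](mulr1 y); apply: cvgM; first exact: cvg_cst.
exact: (cvg_comp _ _ yn sin'0).
Qed.
End sine_bounds.

Section sqrt_iteration.
Context (R : realType).

(** The classical polynomial iteration for the square root of a^2. As a function
    of a it depends on a^2 only, which keeps it within the trigonometric
    polynomials when a is the absolute value of one. *)
Fixpoint sqrt_iter (a : R) n : R :=
  if n is m.+1 then sqrt_iter a m + 2^-1 * (a ^+ 2 - sqrt_iter a m ^+ 2) else 0.

(** One step multiplies the error a - r by 1 - (a + r) / 2, which lies between
    0 and 1 - a / 2. *)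
Lemma sqrt_iter_bounds (a : R) n : 0 <= a <= 1 ->
  0 <= sqrt_iter a n <= a /\ a - sqrt_iter a n <= (1 - a / 2) ^+ n.
Proof.
move=> a01; elim: n => [|n [IH1 IH2]]/=; first by rewrite expr0; lra.
set r := sqrt_iter a n in IH1 IH2 *.
split; first by nra.
have -> : a - (r + 2^-1 * (a ^+ 2 - r ^+ 2)) = (1 - (a + r) / 2) * (a - r).
  by field.
by rewrite exprS; apply: ler_pM => //; lra.
Qed.

Lemma cvg_sqrt_iter (a : R) : 0 <= a <= 1 -> sqrt_iter a n @[n --> \oo] --> a.
Proof.
move=> a01; have [->|a0] := eqVneq a 0.
  rewrite (_ : sqrt_iter 0 = fun=> 0); first exact: cvg_cst.
  by apply/funext; elim=> //= n ->; rewrite !expr0n subrr mulr0 addr0.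
apply: (@squeeze_cvgr _ _ _ _ (fun n => a - (1 - a / 2) ^+ n) (fun=> a)).
- by apply: nearW => n; have := sqrt_iter_bounds n a01; lra.
- rewrite -[X in _ --> X]subr0; apply: cvgB; first exact: cvg_cst.
  apply: cvg_expr; rewrite ger0_norm; first lra.
  by move: a0 a01; rewrite neq_lt; lra.
- exact: cvg_cst.
Qed.
End sqrt_iteration.

(** A difference quotient of |x - a|, normalized to be 0 to the left of a and
    1 to the right of a + 1 / m; as m grows it converges to the indicator of
    ]a, +oo[. *)
Definition ramp (R : realType) (a m x : R) : R :=
  2^-1 * (m * (`|x - a| - `|x - (a + m^-1)|) + 1).

Lemma ramp_left (R : realType) (a m x : R) : 0 < m -> x <= a -> ramp a m x = 0.
Proof.
move=> m0 xa; have mV0 : 0 < m^-1 by rewrite invr_gt0.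
have x1 : x - a <= 0 by lra.
have x2 : x - (a + m^-1) <= 0 by lra.
by rewrite /ramp !ler0_norm//; field; rewrite gt_eqF.
Qed.

Lemma ramp_right (R : realType) (a m x : R) :
  0 < m -> a + m^-1 <= x -> ramp a m x = 1.
Proof.
move=> m0 xa; have mV0 : 0 < m^-1 by rewrite invr_gt0.
have x1 : 0 <= x - a by lra.
have x2 : 0 <= x - (a + m^-1) by lra.
by rewrite /ramp !ger0_norm//; field; rewrite gt_eqF.
Qed.

Lemma ramp_bound (R : realType) (a m x : R) : 0 < m -> `|ramp a m x| <= 1.
Proof.
move=> m0; have : `| `|x - a| - `|x - (a + m^-1)| | <= m^-1.
  rewrite (le_trans (ler_dist_dist _ _))//.
  by rewrite (_ : _ - _ = m^-1) ?gtr0_norm ?invr_gt0//; ring.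
rewrite /ramp; set u := _ - `|_| => um.
have : `|m * u| <= 1 by rewrite normrM gtr0_norm// -ler_pdivlMl// mulr1.
by rewrite !ler_norml; lra.
Qed.

(** * Laws on the real line determined by their characteristic functions *)

Lemma bounded_integrable (disp : measure_display) (T : measurableType disp)
    (R : realType) (P : probability T R) (f : T -> R) C :
  measurable_fun [set: T] f -> (forall x, `|f x| <= C) ->
  P.-integrable setT (EFin \o f).
Proof.
move=> mf fC; apply: measurable_bounded_integrable => //.
  by rewrite (le_lt_trans (probability_le1 P measurableT))// ltry.
exists C; split; first by rewrite num_real.
by move=> D CD x _ /=; rewrite (le_trans (fC x))// ltW.
Qed.

Section same_integral.
Context (R : realType) (mu nu : probability (measurableTypeR R) R).

Definition same_integral (f : R -> R) : Prop :=
  [/\ measurable_fun [set: measurableTypeR R] f, exists C, forall x, `|f x| <= C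
    & (\int[mu]_x f x = \int[nu]_x f x)%R].

Lemma same_integralD f g : same_integral f -> same_integral g ->
  same_integral (fun x => f x + g x).
Proof.
move=> [mf [C fC] fE] [mg [D gD] gE]; split; first exact: measurable_funD.
- by exists (C + D) => x; rewrite (le_trans (ler_normD _ _))// lerD.
- by rewrite !RintegralD ?fE ?gE//;
    (exact: bounded_integrable mf fC || exact: bounded_integrable mg gD).
Qed.

Lemma same_integralZ a f : same_integral f -> same_integral (fun x => a * f x).
Proof.
move=> [mf [C fC] fE]; split; first exact: measurable_funM.
- by exists (`|a| * C) => x; rewrite normrM ler_wpM2l.
- by rewrite !RintegralZl ?fE//; exact: bounded_integrable mf fC.
Qed.

(** Dominated convergence, the constant C being integrable for a probability. *)
Lemma same_integral_lim (f_ : nat -> R -> R) f C :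
  (forall n, same_integral (f_ n)) -> (forall n x, `|f_ n x| <= C) ->
  (forall x, f_ n x @[n --> \oo] --> f x) -> same_integral f.
Proof.
move=> sf fC ff.
have mf : measurable_fun [set: measurableTypeR R] f.
  apply: (@measurable_fun_cvg _ _ _ _ f_) => [n|x _]; last exact: ff.
  by case: (sf n).
have bf x : `|f x| <= C.
  by apply: cvgr_to_le (cvg_norm (ff x)) _; apply: nearW => n; exact: fC.
split => //; first by exists C.
have dct (P : probability (measurableTypeR R) R) :
    (\int[P]_x (f_ n x)%:E)%E @[n --> \oo] --> (\int[P]_x (f x)%:E)%E.
  apply: (dominated_cvg measurableT _ _ (g := fun=> `|C|%:E)) => //=.
  - by move=> n; apply/measurable_EFinP; case: (sf n).
  - by move=> x _; apply: cvg_EFin; [exact: nearW|exact: ff].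
  - apply: (@bounded_integrable _ _ _ P (fun=> `|C|) `|C|) => //= x.
    by rewrite normr_id.
  - by move=> n x _; rewrite lee_fin (le_trans (fC n x))// ler_norm.
rewrite /Rintegral; congr fine; apply: (cvg_unique _ (dct mu)) => //.
apply: cvg_trans (dct nu); apply: near_eq_cvg; apply: nearW => n.
have [mfn _ fnE] := sf n.
have fin (P : probability (measurableTypeR R) R) :
    (\int[P]_x (f_ n x)%:E)%E \is a fin_num.
  by apply: integrable_fin_num => //; exact: bounded_integrable mfn (fC n).
by rewrite -(fineK (fin mu)) -(fineK (fin nu)); congr EFin.
Qed.

Inductive trig_poly : (R -> R) -> Prop :=
| trig_cos t s : trig_poly (fun x => cos (t * x + s))
| trigD f g : trig_poly f -> trig_poly g -> trig_poly (fun x => f x + g x)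
| trigZ a f : trig_poly f -> trig_poly (fun x => a * f x).

(** The product-to-sum formula for two cosines, extended by bilinearity. *)
Lemma trigM f g : trig_poly f -> trig_poly g -> trig_poly (fun x => f x * g x).
Proof.
move=> tf tg; elim: tf => [t s|f1 f2 _ t1 _ t2|a f1 _ t1].
- elim: tg => [t' s'|g1 g2 _ t1 _ t2|a g1 _ t1].
  + rewrite (_ : (fun _ => _) = fun x => 2^-1 *
        (cos ((t + t') * x + (s + s')) + cos ((t - t') * x + (s - s')))).
      by apply: trigZ; apply: trigD; exact: trig_cos.
    apply/funext => x.
    have -> : (t + t') * x + (s + s') = (t * x + s) + (t' * x + s') by ring.
    have -> : (t - t') * x + (s - s') = (t * x + s) - (t' * x + s') by ring.
    by move: (t * x + s) (t' * x + s') => u v; rewrite cosD cosB; field.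
  + by under eq_fun do rewrite mulrDr; exact: trigD.
  + by under eq_fun do rewrite mulrCA; exact: trigZ.
- by under eq_fun do rewrite mulrDl; exact: trigD.
- by under eq_fun do rewrite -mulrA; exact: trigZ.
Qed.

Lemma trig_sin t s : trig_poly (fun x => sin (t * x + s)).
Proof. by under eq_fun do rewrite -cosBpihalf -addrA; exact: trig_cos. Qed.

Lemma trig_sqrt_iter t s n :
  trig_poly (fun x => sqrt_iter `|sin (t * x + s)| n).
Proof.
elim: n => [|n IHn]/=.
  rewrite (_ : (fun=> 0) = fun x => 0 * cos (0 * x + 0)).
    by apply: trigZ; exact: trig_cos.
  by apply/funext => x; rewrite mul0r.
apply: trigD => //; apply: trigZ.
under eq_fun do rewrite real_normK ?num_real// -mulN1r !expr2.
apply: trigD; last by apply: trigZ; exact: trigM.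
by apply: trigM; exact: trig_sin.
Qed.

Context (cosE : forall t s,
  (\int[mu]_x cos (t * x + s) = \int[nu]_x cos (t * x + s))%R).

Lemma same_integral_trig f : trig_poly f -> same_integral f.
Proof.
elim=> [t s|*|*]; [split|exact: same_integralD|exact: same_integralZ] => //.
- apply: continuous_measurable_fun => x.
  apply: continuous_comp; last exact: continuous_cos.
  by apply: cvgD; [apply: cvgM; [exact: cvg_cst|exact: cvg_id]|exact: cvg_cst].
- by exists 1 => x; exact: cos_max.
Qed.

Lemma same_integral_abs_sin t s : same_integral (fun x => `|sin (t * x + s)|).
Proof.
have sin01 x : 0 <= `|sin (t * x + s)| <= 1 by rewrite normr_ge0 sin_max.
apply: (@same_integral_lim (fun n x => sqrt_iter `|sin (t * x + s)| n) _ 1).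
- by move=> n; apply: same_integral_trig; exact: trig_sqrt_iter.
- move=> n x; have [/andP[r0 ra] _] := sqrt_iter_bounds n (sin01 x).
  by rewrite ger0_norm// (le_trans ra)// sin_max.
- by move=> x; exact: cvg_sqrt_iter.
Qed.

(** Take |sin| at scale m = n + 1: m |sin (y / m)| converges to |y|. A single
    such term is not bounded uniformly in m, but the difference of the terms for
    x - a and x - b is at most |a - b|, since sin is 1-Lipschitz. *)
Lemma same_integral_distB a b : same_integral (fun x => `|x - a| - `|x - b|).
Proof.
apply: (@same_integral_lim (fun n x =>
   n.+1%:R * `|sin (n.+1%:R^-1 * x + - (a / n.+1%:R))|
   + - n.+1%:R * `|sin (n.+1%:R^-1 * x + - (b / n.+1%:R))|) _ `|a - b|).
- move=> n; apply: same_integralD; apply: same_integralZ;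
    exact: same_integral_abs_sin.
- move=> n x; have n0 : 0 < n.+1%:R :> R by rewrite ltr0n.
  rewrite mulNr -mulrBr normrM gtr0_norm// -ler_pdivlMl//.
  rewrite (le_trans (ler_dist_dist _ _))// (le_trans (sin_lipschitz _ _))//.
  rewrite [X in `|X|](_ : _ = n.+1%:R^-1 * (b - a)); last by ring.
  by rewrite normrM gtr0_norm ?invr_gt0// distrC.
- move=> x; have cvg_dist c :
      n.+1%:R * `|sin (n.+1%:R^-1 * x + - (c / n.+1%:R))| @[n --> \oo]
      --> `|x - c|.
    have -> : (fun n => n.+1%:R * `|sin (n.+1%:R^-1 * x + - (c / n.+1%:R))|) =
              (fun n => `|n.+1%:R * sin ((x - c) / n.+1%:R)|).
      apply/funext => n; rewrite normrM gtr0_norm ?ltr0n//.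
      by congr (_ * `|sin _|); ring.
    by apply: cvg_norm; exact: cvg_sin_slope.
  by under eq_fun do rewrite mulNr; apply: cvgB; exact: cvg_dist.
Qed.

Lemma same_integral_ray a : same_integral \1_(`]a, +oo[%classic).
Proof.
have n0 n : 0 < n.+1%:R :> R by rewrite ltr0n.
apply: (@same_integral_lim (fun n => ramp a n.+1%:R) _ 1).
- move=> n; apply: same_integralZ; apply: same_integralD.
    by apply: same_integralZ; exact: same_integral_distB.
  rewrite (_ : (fun=> 1) = fun x => cos (0 * x + 0)).
    by apply: same_integral_trig; exact: trig_cos.
  by apply/funext => x; rewrite mul0r addr0 cos0.
- by move=> n x; exact: ramp_bound.
- move=> x; rewrite indicE; have [xa|ax] := leP x a.
    rewrite memNset/= ?in_itv/= ?andbT ?ltNge ?xa//.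
    by under eq_fun do rewrite ramp_left//; exact: cvg_cst.
  rewrite mem_set/= ?in_itv/= ?andbT//.
  have xa0 : 0 < x - a by rewrite subr_gt0.
  apply: cvg_near_cst; have := near_infty_natSinv_lt (PosNum xa0).
  by apply: filterS => n /= H; rewrite ramp_right//; rewrite -lerBrDl ltW.
Qed.

Theorem probability_eq_of_cos B : measurable B -> mu B = nu B.
Proof.
move=> mB; pose G : set (set R) := [set A | exists x, A = `]x, +oo[%classic].
apply: (@measure_unique _ R (measurableTypeR R) G
  (fun n => `]- n%:R, +oo[%classic) _ _ _ _ mu nu _ _ B mB) => //.
- exact: RGenOInfty.measurableE.
- move=> _ _ [x ->] [y ->]; exists (Num.max x y); apply/seteqP; split=> z /=;
    rewrite !in_itv/= !andbT gt_max => /andP//.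
- by move=> n; eexists.
- apply/seteqP; split=> // x _; exists (Num.bound `|x|) => //=.
  rewrite in_itv/= andbT ltrNl; apply: le_lt_trans (archi_boundP (normr_ge0 x)).
  by rewrite -normrN ler_norm.
- move=> _ [x ->]; have [_ _] := same_integral_ray x.
  have fin (P : probability (measurableTypeR R) R) :
      (P `]x, +oo[%classic) \is a fin_num by exact: fin_num_measure.
  rewrite /Rintegral !integral_indic// !setIT => E.
  by rewrite -[LHS](fineK (fin mu)) -[RHS](fineK (fin nu)); congr EFin.
- by move=> n; rewrite (le_lt_trans (probability_le1 _ _))// ltry.
Qed.

End same_integral.

(** * Borel measurability and characteristic functions *)

Section measurability.
Context (R : realType).

Lemma borel_measurable (X Y : ptopologicalType) (f : X -> Y) : continuous f ->
  measurable_fun [set: g_sigma_algebraType (@open X)]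
    (f : g_sigma_algebraType (@open X) -> g_sigma_algebraType (@open Y)).
Proof.
move=> /continuousP cf.
refine (@measurability _ _ _ (g_sigma_algebraType (@open Y)) setT _
  (@open Y) _ _); first by [].
by move=> _ [B oB <-]; rewrite setTI; apply: sub_sigma_algebra; exact: cf.
Qed.

(** The sigma-algebra of the reals is generated by half-open intervals rather
    than by open sets, hence this variant of [borel_measurable] and the next
    one. *)
Lemma borel_measurable_to_R (X : ptopologicalType) (f : X -> R) :
  continuous f ->
  measurable_fun [set: g_sigma_algebraType (@open X)]
    (f : g_sigma_algebraType (@open X) -> measurableTypeR R).
Proof.
move=> /continuousP cf; apply: (measurability _ (RGenOpens.measurableE R)).
move=> _ [_ [a [b ->]] <-]; rewrite setTI; apply: sub_sigma_algebra.
exact/cf/interval_open.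
Qed.

Lemma borel_measurable_from_R (Y : ptopologicalType) (f : R -> Y) :
  continuous f ->
  measurable_fun [set: measurableTypeR R]
    (f : measurableTypeR R -> g_sigma_algebraType (@open Y)).
Proof.
move=> /continuousP cf.
refine (@measurability _ _ _ (g_sigma_algebraType (@open Y)) setT _
  (@open Y) _ _); first by [].
by move=> _ [B oB <-]; rewrite setTI; apply: open_measurable; exact: cf.
Qed.

Lemma continuous_rV (X : topologicalType) d (f : X -> 'rV[R]_d) :
  (forall i, continuous (fun x => f x 0 i)) -> continuous f.
Proof.
move=> cf x A [P PA sA]; rewrite /= nbhs_simpl.
apply: (@filterS _ (nbhs x) _ (fun y => forall i, P 0 i (f y 0 i))).
  by move=> y Py; apply: sA => i j; rewrite (ord1 i).
by apply: filter_forall => i; apply: (cf i x); exact: PA.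
Qed.

Lemma continuous_dotrv d (v : 'rV[R]_d) : continuous (fun x => dotrv x v).
Proof.
rewrite /dotrv; apply: continuous_big => [|i _ x]; first exact: add_continuous.
exact: (cvgM (@coord_continuous R 1 d 0 i x) (cvg_cst (v 0 i))).
Qed.

(** Coordinatewise, an affine map is a constant plus a scalar product with a
    fixed vector. *)
Lemma continuous_affine d (mu : 'rV[R]_d) (A : 'M[R]_d) :
  continuous (fun x : 'rV[R]_d => mu + (x - mu) *m A : 'rV[R]_d).
Proof.
apply: continuous_rV => i x.
rewrite (_ : (fun y => _) = (fun y : 'rV[R]_d =>
   (mu 0 i - dotrv mu (col i A)^T) + dotrv y (col i A)^T)); last first.
  apply/funext => y.
  rewrite !mxE /dotrv -addrA -sumrN addrA addrAC -addrA -big_split/=.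
  by congr (_ + _); apply: eq_bigr => j _; rewrite !mxE; ring.
exact: (cvgD (cvg_cst _) (@continuous_dotrv d (col i A)^T x)).
Qed.
End measurability.

(** The measure is the pushforward of P; it is packaged as a probability
    together with the change of variables formula. *)
Lemma image_probability (disp disp' : measure_display) (T : measurableType disp)
    (T' : measurableType disp') (R : realType) (P : probability T R)
    (f : T -> T') :
  measurable_fun [set: T] f -> exists Q : probability T' R,
    (forall B, Q B = P (f @^-1` B)) /\
    forall (g : T' -> R) C, measurable_fun [set: T'] g ->
      (forall y, `|g y| <= C) -> (\int[Q]_y g y = \int[P]_x g (f x))%R.
Proof.
move=> mf; pose X : {mfun T >-> T'} := mfun_Sub (mem_set mf).
exists (distribution P X); split=> // g C mg gC.
rewrite /Rintegral; congr fine.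
rewrite (integral_pushforward mf) ?preimage_setT//.
- exact/measurable_EFinP.
- apply: (@bounded_integrable _ _ _ P (g \o f) C) => //.
    exact: measurableT_comp.
  by move=> x; exact: gC.
Qed.

Section characteristic_functions.
Context (R : realType).
Local Open Scope complex_scope.

Lemma expi0 : expi (0 : R) = 1.
Proof. by rewrite /expi cos0 sin0. Qed.

Lemma expiD (s t : R) : expi (s + t) = expi s * expi t.
Proof. by rewrite /expi cosD sinD; congr (_ +i* _); rewrite addrC. Qed.

Lemma expi_unit (s : R) : expi (- s) * expi s = 1.
Proof. by rewrite -expiD addNr expi0. Qed.

Context (disp : measure_display) (T : measurableType disp).
Context (P : probability T R).

(** The addition formulas for cos and sin, integrated. *)
Lemma cintegral_expi_shift (X : T -> R) c : measurable_fun setT X ->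
  cintegral P (fun x => expi (c + X x)) =
  expi c * cintegral P (fun x => expi (X x)).
Proof.
move=> mX.
have mc : measurable_fun setT (fun x => cos (X x)).
  exact: measurableT_comp (continuous_measurable_fun (@continuous_cos R)) mX.
have ms : measurable_fun setT (fun x => sin (X x)).
  exact: measurableT_comp (continuous_measurable_fun (@continuous_sin R)) mX.
have ic a : P.-integrable setT (EFin \o (fun x => a * cos (X x))).
  apply: (@bounded_integrable _ _ _ P _ `|a|); first exact: measurable_funM.
  by move=> x; rewrite normrM ler_piMr// cos_max.
have is_ a : P.-integrable setT (EFin \o (fun x => a * sin (X x))).
  apply: (@bounded_integrable _ _ _ P _ `|a|); first exact: measurable_funM.
  by move=> x; rewrite normrM ler_piMr// sin_max.
have ic1 : P.-integrable setT (EFin \o (fun x => cos (X x))).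
  by apply: (@bounded_integrable _ _ _ P _ 1) => // x; exact: cos_max.
have is1 : P.-integrable setT (EFin \o (fun x => sin (X x))).
  by apply: (@bounded_integrable _ _ _ P _ 1) => // x; exact: sin_max.
rewrite /cintegral/=; congr (_ +i* _).
- under eq_Rintegral do rewrite cosD.
  by rewrite RintegralB// !RintegralZl.
- under eq_Rintegral do rewrite sinD addrC.
  by rewrite RintegralD// !RintegralZl// addrC.
Qed.

Lemma cintegral_expi_cst c : cintegral P (fun=> expi c) = expi c.
Proof.
rewrite /cintegral/= !Rintegral_cst// [X in fine X](_ : _ = 1%E).
  by rewrite /= !mulr1.
exact: (probability_setT P).
Qed.

Lemma cintegral_image (disp' : measure_display) (T' : measurableType disp')
    (Q : probability T' R) (f : T -> T') (X : T' -> R) :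
  (forall (g : T' -> R) C, measurable_fun [set: T'] g ->
      (forall y, `|g y| <= C) -> (\int[Q]_y g y = \int[P]_x g (f x))%R) ->
  measurable_fun setT X ->
  cintegral Q (fun y => expi (X y)) = cintegral P (fun x => expi (X (f x))).
Proof.
move=> QE mX; congr (_ +i* _).
- apply: (QE _ 1) => [|y]; last exact: cos_max.
  exact: measurableT_comp (continuous_measurable_fun (@continuous_cos R)) mX.
- apply: (QE _ 1) => [|y]; last exact: sin_max.
  exact: measurableT_comp (continuous_measurable_fun (@continuous_sin R)) mX.
Qed.

End characteristic_functions.

(** Stated for random variables on arbitrary spaces, so that it applies to
    projections of measures on R^d and to constants alike. *)
Theorem law_eq_of_charfun (R : realType) (disp disp' : measure_display)
    (T : measurableType disp) (T' : measurableType disp')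
    (P : probability T R) (Q : probability T' R) (X : T -> R) (Y : T' -> R) :
  measurable_fun setT X -> measurable_fun setT Y ->
  (forall t, cintegral P (fun x => expi (t * X x)) =
             cintegral Q (fun y => expi (t * Y y))) ->
  forall B : set (measurableTypeR R), measurable B ->
    P (X @^-1` B) = Q (Y @^-1` B).
Proof.
move=> mX mY XY B mB.
have [mu [muE imu]] := image_probability P (T' := measurableTypeR R) mX.
have [nu [nuE inu]] := image_probability Q (T' := measurableTypeR R) mY.
rewrite -muE -nuE; apply: probability_eq_of_cos => // t s.
have mcos : measurable_fun [set: measurableTypeR R] (fun x => cos (t * x + s)).
  apply: continuous_measurable_fun => x.
  apply: continuous_comp; last exact: continuous_cos.
  by apply: cvgD; [apply: cvgM; [exact: cvg_cst|exact: cvg_id]|exact: cvg_cst].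
rewrite (imu _ _ mcos (fun=> cos_max _)) (inu _ _ mcos (fun=> cos_max _)).
under eq_Rintegral do rewrite addrC.
under [RHS]eq_Rintegral do rewrite addrC.
have mtX : measurable_fun setT (fun x => t * X x) by exact: measurable_funM.
have mtY : measurable_fun setT (fun x => t * Y x) by exact: measurable_funM.
have : cintegral P (fun x => expi (s + t * X x)) =
       cintegral Q (fun y => expi (s + t * Y y)).
  by rewrite cintegral_expi_shift// XY -cintegral_expi_shift.
by case.
Qed.

(** * Elliptical distributions and their projections *)

Section projections.
Context (R : realType) (d : nat).
Local Open Scope complex_scope.

Lemma dotrvDl (x y w : 'rV[R]_d) : dotrv (x + y) w = dotrv x w + dotrv y w.
Proof.
by rewrite /dotrv -big_split/=; apply: eq_bigr => i _; rewrite mxE mulrDl.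
Qed.

Lemma dotrv0 (x : 'rV[R]_d) : dotrv x 0 = 0.
Proof. by rewrite /dotrv big1// => i _; rewrite mxE mulr0. Qed.

Lemma measurable_dotrv (v : 'rV[R]_d) :
  measurable_fun [set: borel_space R d]
    ((fun x => dotrv x v) : borel_space R d -> measurableTypeR R).
Proof. exact: borel_measurable_to_R (@continuous_dotrv R d v). Qed.

Lemma charfun0 (P : probability (borel_space R d) R) : charfun P 0 = 1.
Proof.
rewrite /charfun -[RHS]expi0 -(cintegral_expi_cst P 0); congr cintegral.
by apply/funext => x; rewrite dotrv0.
Qed.

Lemma charfun_line (P : probability (borel_space R d) R) t v :
  charfun P (t *: v) = cintegral P (fun x => expi (t * dotrv x v)).
Proof. by congr cintegral; apply/funext => x; rewrite dotrvZr. Qed.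

Lemma eq_charfun (P Q : probability (borel_space R d) R) xi :
  eq_on_measurable P Q -> charfun P xi = charfun Q xi.
Proof.
move=> PQ; rewrite /charfun /cintegral /Rintegral; congr (_ +i* _); congr fine;
  by apply: eq_measure_integral => A mA _; exact: PQ.
Qed.

Lemma hyperplaneE (y : 'rV[R]_d) c :
  hyperplane y c = (fun x => dotrv x y) @^-1` [set c].
Proof. by apply/seteqP; split=> x; rewrite /hyperplane/= dotrvC. Qed.

(** Along y, the characteristic function is that of the constant random variable
    c, so x |-> x . y is almost surely equal to c. *)
Lemma degenerate_of_charfun (P : probability (borel_space R d) R) y c :
  (forall t, charfun P (t *: y) = expi (t * c)) -> P (hyperplane y c) = 1%E.
Proof.
move=> Py; have := @law_eq_of_charfun R _ _ (borel_space R d) (borel_space R d)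
  P P (fun x => dotrv x y) (fun=> c) (measurable_dotrv y) (measurable_cst c).
move=> H; rewrite hyperplaneE; transitivity (P ((fun=> c) @^-1` [set c])).
  refine (H _ [set c] (measurable_set1 c)).
  by move=> t; rewrite cintegral_expi_cst -Py charfun_line.
rewrite [X in P X](_ : _ = setT); first exact: (probability_setT P).
by apply/seteqP; split.
Qed.

(** The orthogonal projection on L = <v> is a measurable function of the real
    variable x . v, whose law is determined by the characteristic function
    along v. *)
Lemma marginal_eq (P Q : probability (borel_space R d) R)
    (L : {vspace 'rV[R]_d}) :
  \dim L = 1%N ->
  (forall t, charfun P (t *: vpick L) = charfun Q (t *: vpick L)) ->
  eq_on_measurable (marginal P L) (marginal Q L).
Proof.
move=> dL PQ B mB; set v := vpick L in PQ.
have vL : v \in L by exact: memv_pick.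
have v0 : v != 0 by rewrite vpick0 -dimv_eq0 dL.
pose g (s : R) : subvs_of L := vsproj L ((s / dotrv v v) *: v).
have projE x : orthproj L x = g (dotrv x v).
  apply: (@orthproj_unique R d L x) => [w wL|w wL]; first exact: orthprojP.
  have LE : L = <[v]>%VS.
    apply/eqP; rewrite eq_sym eqEdim dL dim_vline v0 leqnn andbT.
    by rewrite -memvE.
  move: wL; rewrite {1}LE => /vlineP[k ->].
  rewrite vsprojK ?rpredZ// dotrvZr dotrvBl dotrvZl divfK ?dotrvv_eq0//.
  by rewrite subrr mulr0.
have cg : continuous (g : R -> initial_topology (vsval : subvs_of L -> _)).
  apply/continuousP => _ [A oA <-].
  have cv : continuous (fun s : R => (s / dotrv v v) *: v : 'rV[R]_d).
    apply: continuous_rV => i s.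
    rewrite (_ : (fun y => _) = ( *%R (v 0 i / dotrv v v))); last first.
      by apply/funext => y; rewrite mxE; ring.
    exact: mulrl_continuous.
  move/continuousP : cv => /(_ _ oA); congr open; apply/seteqP.
  by split=> s /=; rewrite /g vsprojK ?rpredZ.
have mg := borel_measurable_from_R cg.
have margE (S : probability (borel_space R d) R) :
    marginal S L B = S ((fun x => dotrv x v) @^-1` (g @^-1` B)).
  rewrite /marginal /pushforward; congr (S _).
  by apply/seteqP; split=> x /=; rewrite projE.
rewrite !margE; apply: law_eq_of_charfun.
- exact: measurable_dotrv.
- exact: measurable_dotrv.
- by move=> t; rewrite -!charfun_line.
- by rewrite -[X in measurable X]setTI; apply: mg.
Qed.

(** If a < b, then psi s = psi (s r) with r = a / b < 1, hence
    psi s = psi (s r^n), which converges to psi 0. *)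
Lemma cst_of_rescale (psi : R -> (R[i] : numFieldType)) (a b : R) :
  {within `[0, +oo[, continuous psi} -> 0 < a -> 0 < b -> a != b ->
  (forall t, psi (t ^+ 2 * a) = psi (t ^+ 2 * b)) ->
  forall s, 0 <= s -> psi s = psi 0.
Proof.
move=> cpsi; wlog ab : a b / a < b.
  move=> H a0 b0 neq E; have [ab|ba|eq_ab] := ltgtP a b; first exact: (H a b).
    by rewrite eq_sym in neq; apply: (H b a ba b0 a0 neq) => t; rewrite E.
  by rewrite eq_ab eqxx in neq.
move=> a0 b0 _ E s s0; pose r := a / b.
have r0 : 0 <= r by rewrite divr_ge0// ltW.
have r1 : r < 1 by rewrite ltr_pdivrMr ?mul1r.
have step u : 0 <= u -> psi u = psi (u * r).
  move=> u0; have := E (Num.sqrt (u / b)).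
  rewrite sqr_sqrtr ?divr_ge0// ?ltW// divfK ?gt_eqF// => <-.
  by congr psi; rewrite /r; ring.
have iter n : psi s = psi (s * r ^+ n).
  elim: n => [|n ->]; first by rewrite expr0 mulr1.
  rewrite (step (s * r ^+ n)); last by rewrite mulr_ge0// exprn_ge0.
  by rewrite exprSr -[in LHS]mulrA.
have psi_cvg : psi (s * r ^+ n) @[n --> \oo] --> psi 0.
  have /subspace_continuousP/(_ 0) cpsi0 := cpsi.
  have {}cpsi0 := cpsi0 ltac:(by rewrite /= in_itv/= lexx).
  apply: (cvg_comp _ _ _ cpsi0) => A A0.
  have u0 : s * r ^+ n @[n --> \oo] --> (0 : R).
    rewrite -[X in _ --> X](mulr0 s).
    by apply: cvgM; [exact: cvg_cst|apply: cvg_expr; rewrite ger0_norm].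
  have : \forall n \near \oo, `[0, +oo[%classic (s * r ^+ n) -> A (s * r ^+ n).
    exact: u0 _ A0.
  apply: filterS => n; apply.
  by rewrite /= in_itv/= andbT mulr_ge0// exprn_ge0.
have psi_cst : psi (s * r ^+ n) @[n --> \oo] --> psi s.
  by rewrite (_ : (fun n => _) = fun=> psi s); [exact: cvg_cst|exact/funext].
exact: (cvg_unique (@norm_hausdorff _ (R[i] : numFieldType)) psi_cst psi_cvg).
Qed.

End projections.

Section elliptical_measures.
Context (R : realType) (d : nat).
Local Open Scope complex_scope.
Implicit Types (P Q : probability (borel_space R d) R).

(** If the form vanishes at x <> 0, the characteristic function along x is that
    of a Dirac mass. *)
Lemma pos_def_of_nondegenerate P mu (S : 'M[R]_d) (psi : R -> R[i]) :
  nondegenerate_measure P -> pos_semidef S ->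
  (forall xi, charfun P xi = expi (dotrv mu xi) * psi (quad_form S xi)) ->
  psi 0 = 1 -> pos_def S.
Proof.
move=> nP [Ssym Spos] PE psi0; split=> // x x0; rewrite lt_def Spos andbT.
apply/eqP => Sx; apply: (nP x (dotrv mu x) x0).
apply: degenerate_of_charfun => t.
by rewrite PE quad_form_scale Sx mulr0 psi0 mulr1 dotrvZr.
Qed.

(** With f the affine map, f x . xi is x . (xi A) plus a constant that depends
    on xi, and a constant shift multiplies the characteristic function by a
    phase. *)
Lemma affine_image P (mu : 'rV[R]_d) (A : 'M[R]_d) : exists Q,
  (forall B, Q B = P ((fun x => mu + (x - mu) *m A^T) @^-1` B)) /\
  forall xi, charfun Q xi =
    expi (dotrv mu xi - dotrv mu (xi *m A)) * charfun P (xi *m A).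
Proof.
have mf := borel_measurable (@continuous_affine R d mu A^T).
have [Q [QE QI]] := @image_probability _ _ (borel_space R d)
  (borel_space R d) R P _ mf.
exists Q; split=> // xi.
rewrite /charfun (cintegral_image QI (measurable_dotrv xi)).
rewrite -cintegral_expi_shift; last exact: measurable_dotrv.
congr cintegral; apply/funext => x.
by rewrite dotrvDl dotrv_mul dotrvBl; congr expi; ring.
Qed.

End elliptical_measures.

Theorem corollary2 (R : realType) (d : nat) (hd : (1 <= d)%N)
    (P : probability (borel_space R d) R)
    (P_nondegenerate : nondegenerate_measure P) (P_elliptical : elliptical P)
    (LL : set {vspace 'rV[R]_d})
    (LL_lines : forall L : {vspace 'rV[R]_d}, LL L -> \dim L = 1%N)
    (n : nat) (LL_card : LL #= `I_n) (hn : (n < (d ^ 2 + d) %/ 2)%N) :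
  exists Q : probability (borel_space R d) R,
    [/\ nondegenerate_measure Q, elliptical Q,
        forall L : {vspace 'rV[R]_d}, LL L ->
          eq_on_measurable (marginal P L) (marginal Q L)
      & ~ eq_on_measurable P Q].
Proof.
have [mu [S [psi [Spsd cpsi PE]]]] := P_elliptical.
have psi0 : psi 0 = 1.
  have := PE 0; rewrite charfun0 dotrv0 expi0 mul1r => ->; congr psi.
  by rewrite /quad_form !mul0mx mxE.
have Spd := pos_def_of_nondegenerate P_nondegenerate Spsd PE psi0.
have [f [f_lt f_inj _]] := card_set_bijP LL_card.
(* Enumerates the lines; the default 0 is never met at an index f L. *)
pose line (k : nat) := xget 0%VS [set L | LL L /\ f L = k].
have lineE L : LL L -> line (f L) = L.
  move=> LLL; have [|LLl fl] := @xgetPex _ 0%VS [set L' | LL L' /\ f L' = f L].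
    by exists L.
  by apply: f_inj; rewrite ?inE.
have [M [Msym M0 Miso]] := isotropic_form (fun k : 'I_n => vpick (line k)) hn.
have [e e0 [A Au AE]] := congruent_perturbation Spd Msym.
have quadA xi : quad_form S (xi *m A) = quad_form S xi + e * quad_form M xi.
  by rewrite -quad_form_congr AE quad_formD quad_formZ.
have xA0 xi : xi != 0 -> xi *m A != 0.
  by apply: contra_neq => xiA; rewrite -(mulmxK Au xi) xiA mul0mx.
have [Q [QE Qphi]] := affine_image P mu A.
have {}Qphi xi :
    charfun Q xi = expi (dotrv mu xi) * psi (quad_form S (xi *m A)).
  by rewrite Qphi PE mulrA -expiD subrK.
exists Q; split.
- move=> y c y0; rewrite QE.
  rewrite (_ : _ @^-1` _ =
    hyperplane (y *m A) (c - dotrv mu y + dotrv mu (y *m A))).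
    exact/P_nondegenerate/xA0.
  rewrite !hyperplaneE; apply/seteqP; split=> x /=;
    rewrite dotrvDl dotrv_mul dotrvBl; lra.
- exists mu, (A *m S *m A^T), psi; split=> // [|xi].
    split=> [|x]; first by rewrite !trmx_mul trmxK (proj1 Spsd) mulmxA.
    by rewrite quad_form_congr (proj2 Spsd).
  by rewrite Qphi quad_form_congr.
- move=> L LLL; apply: marginal_eq; first exact: LL_lines.
  move=> t; rewrite PE Qphi quadA; congr (_ * psi _).
  have := Miso (Ordinal (f_lt _ LLL)); rewrite /= lineE// => ML.
  by rewrite (quad_form_scale M) ML !mulr0 addr0.
- move=> PQ.
  have [x Mx] := quad_form_neq0 Msym M0.
  have x0 : x != 0.
    by apply: contraNneq Mx => ->; rewrite /quad_form !mul0mx mxE.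
  have psi_scale t :
      psi (t ^+ 2 * quad_form S x) = psi (t ^+ 2 * quad_form S (x *m A)).
    have := eq_charfun (t *: x) PQ; rewrite PE Qphi -scalemxAl !quad_form_scale.
    move=> /(congr1 ( *%R (expi (- dotrv mu (t *: x))))).
    by rewrite !mulrA expi_unit !mul1r.
  have psi1 s : 0 <= s -> psi s = 1.
    have Sx : 0 < quad_form S x by exact: (proj2 Spd).
    have SxA : 0 < quad_form S (x *m A) by exact/(proj2 Spd)/xA0.
    have neq : quad_form S x != quad_form S (x *m A).
      by rewrite quadA -subr_eq0 opprD addNKr oppr_eq0 mulf_neq0// gt_eqF.
    by move=> s0; rewrite (cst_of_rescale cpsi Sx SxA neq psi_scale s0).
  apply: (P_nondegenerate x (dotrv mu x) x0); apply: degenerate_of_charfun => t.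
  by rewrite PE psi1 ?mulr1 ?dotrvZr// (proj2 Spsd).
Qed.
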